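(* Let $A=\{a_1,\dots,a_K\}$ be a finite set of items, $\mathcal{F}$ an antimonotonic family of itemsets over $A$, $\theta$ frequencies for $\mathcal{F}$, and $f$ a query function depending only on a set $B\subseteq A$ via $f(p)=f_B(\pi_Bp)$. Let $C$ be the safe set containing $B$ of minimum cardinality among safe sets containing $B$. Let $H$ be a graph obtained from the dependency graph of $\pi_C\mathcal{F}$ (vertex set $C$) by first adding all edges between items of $B$ and then adding edges so that the resulting graph is triangulated. Let $T$ be a junction tree of $H$ with cliques $Q_1,\dots,Q_m$ and separators $S_1,\dots,S_n$, and let $Q_r$ be a clique with $B\subseteq Q_r$. Consider Problem LP: minimise $f_B(\pi_Bp_r)$ over distributions $p_i$ on $\{0,1\}^{Q_i}$ ($i=1,\dots,m$) and $q_j$ on $\{0,1\}^{S_j}$ ($j=1,\dots,n$) subject to: each $p_i$ satisfies $\pi_{Q_i}\theta$, and $\pi_{S_j}p_i=q_j$ for every separator $S_j$ incident to $Q_i$. Then Problem LP correctly solves the optimisation problem: its minimum value equals the minimum of $f(p)$ over all distributions $p$ on $\{0,1\}^K$ satisfying $\theta$.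
   Context: An itemset is a subset $U\subseteq A$ with $S_U(z)=1$ iff $z_i=1$ for all $a_i\in U$. $\mathcal{F}$ is antimonotonic if closed under subsets. A distribution $p$ on $\{0,1\}^K$ satisfies $\theta=(\theta_U)_{U\in\mathcal{F}}$ if $E_p[S_U]=\theta_U$ for all $U\in\mathcal{F}$; ''frequencies for $\mathcal{F}$'' are such $\theta$ satisfied by some distribution. For $D\subseteq A$: $\pi_D\mathcal{F}=\{U\in\mathcal{F}:U\subseteq D\}$, $\pi_D\theta=(\theta_U)_{U\in\pi_D\mathcal{F}}$, $\pi_D p$ is the marginal of a distribution $p$ on the coordinates indexed by $D$ (also applied to distributions on $\{0,1\}^{D'}$ with $D\subseteq D'$), and a distribution $q$ on $\{0,1\}^D$ satisfies $\pi_D\theta$ if $E_q[S_U]=\theta_U$ for all $U\in\pi_D\mathcal{F}$. $D$ is safe if for all frequencies $\theta'$ for $\mathcal{F}$, every distribution on $\{0,1\}^D$ satisfying $\pi_D\theta'$ has an extension $p$ on $\{0,1\}^K$ (with $\pi_Dp$ equal to it) satisfying $\theta'$. A query function $f$ maps distributions on $\{0,1\}^K$ to $\mathbb{R}$; $f_B$ is a function on distributions on $\{0,1\}^B$. The dependency graph of a family $\mathcal{G}$ of itemsets over a vertex set $D$ has an edge $\{a,b\}$ ($a\ne b$) iff $\{a,b\}\in\mathcal{G}$. A graph is triangulated if it has no chordless cycle of length $\ge4$. A junction tree of a graph $H$ is a spanning tree $T$ of its clique graph (vertices: maximal cliques of $H$; adjacent iff they share a vertex) such that if two cliques contain a vertex,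 every clique on the $T$-path between them contains it; each edge of $T$ is a separator, identified with the set of vertices common to its two cliques. Minimum values are infima over feasible sets. *)

(* Defs.v *)
From HB Require Import structures.
From mathcomp Require Import all_boot all_order all_algebra.
From mathcomp Require Import classical_sets reals ereal.

Set Implicit Arguments.
Unset Strict Implicit.
Unset Printing Implicit Defensive.

Import Order.TTheory GRing.Theory Num.Theory.

Local Open Scope ring_scope.

(** The cube {0,1}^K over all the items is [bits [set: A]]. *)

Section Distributions.
Variables (R : realType) (A : finType).
Implicit Types (D U : {set A}) (F : {set {set A}}).

Definition bits D := {ffun {a : A | a \in D} -> bool}.

(** Coordinate projection.  It is only meant for [D \subset D']; making it total
    (coordinates of [D] that are not in [D'] are set to 0) spares an inclusion
    proof in every marginal. *)
Definition restrict D' D (z : bits D') : bits D :=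
  [ffun a : {a : A | a \in D} => oapp z false (insub (val a))].

Record distr D := Distr {
  dval :> {ffun bits D -> R};
  _ : [forall z, 0 <= dval z] && (\sum_z dval z == 1) }.

HB.instance Definition _ D := [isSub for @dval D].

Fact marginal_subproof D' D (p : distr D') :
  let q := [ffun z : bits D => \sum_(z' : bits D' | restrict D z' == z) p z'] in
  [forall z, 0 <= q z] && (\sum_z q z == 1).
Proof.
case: p => p /= /andP[/forallP p_ge0 /eqP p_sum1]; apply/andP; split.
  by apply/forallP => z; rewrite ffunE sumr_ge0.
apply/eqP; under eq_bigr do rewrite ffunE.
by rewrite -p_sum1 [RHS](partition_big (@restrict D' D) xpredT).
Qed.

Definition marginal D' D (p : distr D') : distr D :=
  Distr (marginal_subproof D p).

(** [S_U] on {0,1}^D; only meant for [U \subset D]. *)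
Definition itemset_ind D U (z : bits D) : bool :=
  [forall a : {a : A | a \in D}, (val a \in U) ==> z a].

Definition expectation D (p : distr D) (g : bits D -> R) : R :=
  \sum_z p z * g z.

(** A vector [(theta_U)_(U in F)] is represented by a function on all itemsets
    whose values outside of [F] are never looked at; hence [pi_D theta] is
    [theta] itself, read along the family [proj F D]. *)
Definition proj F D : {set {set A}} := [set U in F | U \subset D].

Definition satisfies D F (theta : {set A} -> R) (p : distr D) : Prop :=
  forall U, U \in F -> expectation p (fun z => (itemset_ind U z)%:R) = theta U.

Definition frequencies F (theta : {set A} -> R) : Prop :=
  exists p : distr [set: A], satisfies F theta p.

Definition antimonotonic F : Prop :=
  forall U V : {set A}, U \subset V -> V \in F -> U \in F.

Definition safe F D : Prop :=
  forall theta : {set A} -> R, frequencies F theta ->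
  forall q : distr D, satisfies (proj F D) theta q ->
  exists p : distr [set: A], marginal D p = q /\ satisfies F theta p.

Definition min_safe F (B C : {set A}) : Prop :=
  [/\ safe F C, B \subset C &
      forall D, safe F D -> B \subset D -> (#|C| <= #|D|)%N].

End Distributions.

Arguments safe R {A} F D.
Arguments min_safe R {A} F B C.

Section Graphs.
Variable V : finType.
Implicit Types (D Q : {set V}) (e : rel V).

Definition simple_graph D e : Prop :=
  [/\ symmetric e, irreflexive e &
      forall x y, e x y -> (x \in D) && (y \in D)].

Definition triangulated e : Prop :=
  forall c : seq V, ucycle e c -> (4 <= size c)%N ->
  exists x y : V, [/\ x \in c, y \in c, e x y, y != next c x & x != next c y].

Definition clique D e : pred {set V} := fun Q =>
  (Q \subset D) && [forall x in Q, forall y in Q, (x != y) ==> e x y].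

Definition maximal_clique D e Q : bool := maxset (clique D e) Q.

Definition tree e : Prop :=
  [/\ simple_graph [set: V] e, forall x y, connect e x y &
      forall c : seq V, ucycle e c -> (size c < 3)%N].

Definition edges e : {set {set V}} :=
  [set [set u.1; u.2] | u : V * V & e u.1 u.2].

End Graphs.

Section JunctionTree.
Variable A : finType.
Implicit Types (B D : {set A}) (H : rel A).

Definition dependency_graph (G : {set {set A}}) : rel A :=
  fun a b => (a != b) && ([set a; b] \in G).

Definition complete_on B H : rel A :=
  fun a b => H a b || [&& a != b, a \in B & b \in B].

Definition clique_enum D H m (Q : 'I_m -> {set A}) : Prop :=
  injective Q /\ [set Q i | i : 'I_m] = [set K | maximal_clique D H K].

Definition clique_graph m (Q : 'I_m -> {set A}) : rel 'I_m :=
  fun i k => (i != k) && [exists a in Q i, a \in Q k].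

Definition junction_tree m (Q : 'I_m -> {set A}) (T : rel 'I_m) : Prop :=
  [/\ tree T, subrel T (clique_graph Q) &
      forall (i : 'I_m) (s : seq 'I_m), path T i s -> uniq (i :: s) ->
      forall a : A, a \in Q i -> a \in Q (last i s) ->
      forall k : 'I_m, k \in s -> a \in Q k].

(** The separators are indexed by the edges of the tree, not by their vertex
    sets: distinct edges may carry the same set of items. *)
Definition edge_enum m (T : rel 'I_m) n (E : 'I_n -> {set 'I_m}) : Prop :=
  injective E /\ [set E j | j : 'I_n] = edges T.

Definition separator m (Q : 'I_m -> {set A}) (e : {set 'I_m}) : {set A} :=
  [set a | [forall i in e, a \in Q i]].

End JunctionTree.

Section Problems.
Variables (R : realType) (A : finType).
Variables (F : {set {set A}}) (theta : {set A} -> R).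

Definition lp_feasible m (Q : 'I_m -> {set A}) n (E : 'I_n -> {set 'I_m})
    (p : forall i, distr R (Q i))
    (q : forall j, distr R (separator Q (E j))) : Prop :=
  (forall i, satisfies (proj F (Q i)) theta (p i)) /\
  (forall i j, i \in E j -> marginal (separator Q (E j)) (p i) = q j).

(** Infima are taken in the extended reals, since the query function may be
    unbounded below. *)
Definition lp_value (B : {set A}) (fB : distr R B -> R)
    m (Q : 'I_m -> {set A}) n (E : 'I_n -> {set 'I_m}) (r : 'I_m) : \bar R :=
  ereal_inf [set v | exists p q,
    @lp_feasible m Q n E p q /\ v = (fB (marginal B (p r)))%:E]%classic.

Definition opt_value (f : distr R [set: A] -> R) : \bar R :=
  ereal_inf [set (f p)%:E | p in [set p | satisfies F theta p]]%classic.

End Problems.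

(* Main.v *)
Require Import Defs.
From mathcomp Require Import all_boot all_order all_algebra.
From mathcomp Require Import classical_sets reals ereal.

Set Implicit Arguments.
Unset Strict Implicit.
Unset Printing Implicit Defensive.

Import Order.TTheory GRing.Theory Num.Theory.

Local Open Scope ring_scope.

(** Only the gluing of a feasible point of Problem LP into a distribution on
    {0,1}^C is at stake, since safety extends that to {0,1}^K.  One grows a
    connected set [X] of nodes of the junction tree: if the edge [x - y] leaves
    [X], running intersection forces [Q y] to meet the union of the cliques of
    [X] only in the separator of [x - y], so that the distribution built so far
    and [p y] are glued by making them conditionally independent given the
    separator.  An itemset of [F] inside [C] is a clique of [H], hence lies in
    some [Q i], where its frequency is right. *)

(** * Restrictions of bit vectors and marginals *)

Section Marginals.
Variables (R : realType) (A : finType).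
Implicit Types D U : {set A}.

Lemma restrictE D D' (z : bits D) (a : {a | a \in D'}) (aD : val a \in D) :
  restrict D' z a = z (Sub (val a) aD).
Proof. by rewrite ffunE insubT. Qed.

(** A coordinate of [D''] missing from [D] is filled with [false] on both sides, so [D] can be any
    set; [theorem9] uses this freedom for [W] and [C]. *)
Lemma restrict_comp D D' D'' (z : bits D) : D'' \subset D' ->
  restrict D'' (restrict D' z) = restrict D'' z.
Proof.
move=> sD; apply/ffunP => a; rewrite (restrictE _ (fintype.subsetP sD _ (valP a))).
by rewrite !ffunE.
Qed.

Lemma distr_ge0 D (p : distr R D) z : 0 <= p z.
Proof. by case: p => p /= /andP[/forallP]. Qed.

Lemma distr_sum1 D (p : distr R D) : \sum_z p z = 1.
Proof. by case: p => p /= /andP[_ /eqP]. Qed.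

Lemma distrP D (p q : distr R D) : p =1 q -> p = q.
Proof. by move=> pq; apply/val_inj/ffunP. Qed.

Lemma marginalE D D' (p : distr R D) z :
  marginal D' p z = \sum_(z' : bits D | restrict D' z' == z) p z'.
Proof. by rewrite ffunE. Qed.

Lemma marginal_comp D D' D'' (p : distr R D) : D'' \subset D' ->
  marginal D'' (marginal D' p) = marginal D'' p.
Proof.
move=> sD; apply: distrP => z; rewrite !marginalE.
under eq_bigr do rewrite marginalE.
rewrite [RHS](partition_big (@restrict _ D D') (fun w => restrict D'' w == z)).
  apply: eq_bigr => w /eqP wz; apply: eq_bigl => z'.
  case: (restrict D' z' =P w) => [zw|_]; last by rewrite andbF.
  by rewrite andbT -(restrict_comp z' sD) zw wz eqxx.
by move=> z'; rewrite restrict_comp.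
Qed.

Lemma expectation_marginal D D' (p : distr R D) g :
  expectation (marginal D' p) g = expectation p (g \o restrict D').
Proof.
rewrite /expectation; under eq_bigr do rewrite marginalE big_distrl.
rewrite [RHS](partition_big (@restrict _ D D') xpredT) //=.
by apply: eq_bigr => w _; apply: eq_bigr => z /eqP ->.
Qed.

Lemma itemset_ind_restrict D D' U (z : bits D) : U \subset D' -> D' \subset D ->
  itemset_ind U (restrict D' z) = itemset_ind U z.
Proof.
move=> sUD' sD'D; apply/forallP/forallP => zU a; apply/implyP => aU.
  have aD' := fintype.subsetP sUD' _ aU.
  by have := zU (Sub (val a) aD'); rewrite ffunE /= aU valK.
rewrite (restrictE _ (fintype.subsetP sD'D _ (valP a))).
by have := zU (Sub (val a) (fintype.subsetP sD'D _ (valP a))); rewrite aU.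
Qed.

Lemma expectation_itemset_marginal D D' U (p : distr R D) :
  U \subset D' -> D' \subset D ->
  expectation (marginal D' p) (fun z => (itemset_ind U z)%:R) =
  expectation p (fun z => (itemset_ind U z)%:R).
Proof.
move=> sU sD; rewrite expectation_marginal; apply: eq_bigr => z _ /=.
by rewrite itemset_ind_restrict.
Qed.

Lemma satisfies_marginal F (theta : {set A} -> R) D D' (p : distr R D) :
  D' \subset D -> satisfies F theta p ->
  satisfies (proj F D') theta (marginal D' p).
Proof.
move=> sD pF U; rewrite inE => /andP[UF sU]; rewrite -(pF _ UF).
exact: expectation_itemset_marginal.
Qed.

End Marginals.

(** * Gluing two distributions along their overlap *)

Section Gluing.
Variables (R : realType) (A : finType) (D1 D2 D S : {set A}).
Hypotheses (DE : D = D1 :|: D2) (SE : S = D1 :&: D2).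

Lemma restrict_inj2 (z z' : bits D) :
  restrict D1 z = restrict D1 z' -> restrict D2 z = restrict D2 z' -> z = z'.
Proof.
move=> e1 e2; apply/ffunP => a.
have coordE (D' : {set A}) (aD' : val a \in D') : restrict D' z = restrict D' z' ->
    z a = z' a.
  by move/ffunP/(_ (Sub (val a) aD')); rewrite !ffunE /= !valK.
have : val a \in D1 :|: D2 by rewrite -DE (valP a).
rewrite inE => /orP[] aD.
  exact: coordE aD e1.
exact: coordE aD e2.
Qed.

(** On the overlap [w1] prevails; the default [false] is never reached under [DE]. *)
Definition glue (w1 : bits D1) (w2 : bits D2) : bits D :=
  [ffun a => if insub (val a) is Some a1 then w1 a1
             else oapp w2 false (insub (val a))].

Lemma restrict_glue1 w1 w2 : restrict D1 (glue w1 w2) = w1.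
Proof.
apply/ffunP => a; have aD : val a \in D by rewrite DE inE (valP a).
by rewrite (restrictE _ aD) ffunE /= valK.
Qed.

Lemma restrict_glue2 w1 w2 : restrict S w1 = restrict S w2 ->
  restrict D2 (glue w1 w2) = w2.
Proof.
move=> e; apply/ffunP => a.
have aD : val a \in D by rewrite DE inE (valP a) orbT.
rewrite (restrictE _ aD) ffunE /=.
case: insubP => [a1 aD1 a1E|_]; last by rewrite valK.
have aS : val a \in S by rewrite SE inE aD1 (valP a).
by move/ffunP: e => /(_ (Sub (val a) aS)); rewrite !ffunE /= -{1}a1E !valK.
Qed.

(** [glue w1] is a bijection from the vectors on [D2] agreeing with [w1] on [S] to the extensions of
    [w1] to [D], with inverse [restrict D2]. *)
Lemma sum_restrict_glue (w1 : bits D1) (g : bits D2 -> R) :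
  \sum_(z : bits D | restrict D1 z == w1) g (restrict D2 z) =
  \sum_(w2 | restrict S w2 == restrict S w1) g w2.
Proof.
have [sS1 sS2] : S \subset D1 /\ S \subset D2 by rewrite SE subsetIl subsetIr.
rewrite [RHS](reindex_onto (@restrict _ D D2) (glue w1)) /=; last first.
  by move=> w2 /eqP e; rewrite restrict_glue2.
apply: eq_bigl => z; rewrite restrict_comp //.
apply/idP/andP => [/eqP zw1|[_ /eqP <-]]; last by rewrite restrict_glue1.
have e : restrict S w1 = restrict S z by rewrite -zw1 restrict_comp.
rewrite e eqxx; split=> //; apply/eqP/restrict_inj2.
  by rewrite restrict_glue1.
by rewrite restrict_glue2 // e restrict_comp.
Qed.

(** On the fibre over [w1] the factor [q1 w1 / c] is constant, and the values of [q2] add up to its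
    marginal on [S], which is [c] again. *)
Lemma sum_glue (q1 : distr R D1) (q2 : distr R D2) w1 :
  marginal S q1 = marginal S q2 ->
  \sum_(z : bits D | restrict D1 z == w1)
    q1 (restrict D1 z) * q2 (restrict D2 z) / marginal S q1 (restrict S z) =
  q1 w1.
Proof.
move=> q12; pose c := marginal S q1 (restrict S w1).
rewrite (eq_bigr (fun z => q1 w1 / c * q2 (restrict D2 z))); last first.
  move=> z /eqP zw1; rewrite mulrAC zw1 -(@restrict_comp _ D D1) ?zw1 //.
  by rewrite SE subsetIl.
rewrite -big_distrr sum_restrict_glue -marginalE -q12 -/c /=.
(* If [c = 0], then [q1 w1] is one of the nonnegative terms summing to [c], hence zero. *)
have [c0|c_neq0] := eqVneq c 0; last by rewrite mulfVK.
rewrite c0 mulr0; apply/esym/eqP; rewrite eq_le distr_ge0 andbT -c0 /c marginalE.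
by rewrite (bigD1 w1) //= lerDl sumr_ge0 // => w _; apply: distr_ge0.
Qed.

End Gluing.

(** The glued distribution is [q1 * q2 / marginal S q1]; where the denominator
    vanishes so does [q1], and the junk value [x / 0 = 0] is the right one. *)
Lemma distr_glue (R : realType) (A : finType) (D1 D2 S : {set A})
    (q1 : distr R D1) (q2 : distr R D2) :
  S = D1 :&: D2 -> marginal S q1 = marginal S q2 ->
  exists q : distr R (D1 :|: D2), marginal D1 q = q1 /\ marginal D2 q = q2.
Proof.
move=> SE q12; pose g : {ffun bits (D1 :|: D2) -> R} := [ffun z =>
  q1 (restrict D1 z) * q2 (restrict D2 z) / marginal S q1 (restrict S z)].
have g1 w : \sum_(z | restrict D1 z == w) g z = q1 w.
  by under eq_bigr do rewrite ffunE; rewrite (sum_glue _ SE).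
have g2 w : \sum_(z | restrict D2 z == w) g z = q2 w.
  (* Equality of the marginals on [S] makes the formula symmetric in [q1] and [q2]. *)
  under eq_bigr do rewrite ffunE [q1 _ * _]mulrC q12.
  by rewrite (sum_glue (finset.setUC _ _) (etrans SE (finset.setIC _ _))).
have g_distr : [forall z, 0 <= g z] && (\sum_z g z == 1).
  apply/andP; split.
    by apply/forallP => z; rewrite ffunE !(mulr_ge0, invr_ge0, distr_ge0).
  rewrite (partition_big (@restrict _ _ D1) xpredT) //=.
  by under eq_bigr do rewrite g1; rewrite distr_sum1.
by exists (Distr g_distr); split; apply: distrP => w; rewrite marginalE ?g1 ?g2.
Qed.

(** * Growing a connected part of a junction tree *)

Section JunctionTrees.
Variables (A : finType) (m : nat) (Q : 'I_m -> {set A}).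
Variable T : rel 'I_m.
Implicit Types X : {set 'I_m}.

(** Otherwise [X] would be closed under [T], and connectedness would put [k] in it. *)
Lemma tree_frontier X i k : tree T -> i \in X -> k \notin X ->
  exists x y, [/\ x \in X, y \notin X & T x y].
Proof.
move=> [[Tsym _ _] Tconn _] iX kX.
have [/existsP[x /existsP[y /and3P[? ? ?]]]|noxy] :=
  boolP [exists x, exists y, [&& x \in X, y \notin X & T x y]].
  by exists x, y.
have Xclosed : fingraph.closed T X.
  apply: intro_closed; first exact: sym_connect_sym.
  move=> x y Txy xX; apply: contraNT noxy => yX.
  by apply/existsP; exists x; apply/existsP; exists y; apply/and3P.
by rewrite -[k \in X](closed_connect Xclosed (Tconn i k)) iX in kX.
Qed.

(** Constraining the target of each step is enough to keep a path in [X], since its start is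
    there. *)
Definition connected_in X :=
  {in X &, forall i k, connect [rel x y | T x y && (y \in X)] i k}.

Hypothesis QT : junction_tree Q T.

(** A simple path inside [X] from [i] to [x], prolonged by [y], is a simple path of [T]; the
    junction property applies to its ends [i] and [y]. *)
Lemma running_intersection X i x y a : connected_in X ->
  i \in X -> x \in X -> y \notin X -> T x y ->
  a \in Q i -> a \in Q y -> a \in Q x.
Proof.
move=> Xconn iX xX yX Txy aQi aQy.
have /connectP[s0 s0P xE] := Xconn i x iX xX; case/shortenP: s0P xE => s sP us _ xE.
have [Ts sX] : path T i s /\ {subset s <= X}.
  elim: s i iX sP {us xE aQi} => //= k s IHs i iX /andP[/andP[Tik kX] /IHs[]] //.
  by move=> Ts sX; rewrite Tik; split=> // l; rewrite inE => /predU1P[->|/sX].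
have [_ _ rip] := QT.
(* The junction property speaks of the nodes after the first one, so the case [x = i] is set
   apart. *)
have [xs|] := boolP (x \in s); last first.
  case/lastP: s {us sP Ts sX} xE => [->//|s l].
  by rewrite last_rcons => ->; rewrite mem_rcons mem_head.
apply: (rip i (rcons s y)); rewrite ?last_rcons ?mem_rcons ?inE ?xs ?orbT //.
  by rewrite rcons_path Ts -xE.
rewrite -rcons_cons rcons_uniq us andbT inE negb_or.
by rewrite (contraNneq _ yX) => [|->//]; apply: contra yX => /sX.
Qed.

Lemma connected_in_add X x y : connected_in X -> x \in X -> T x y ->
  connected_in (y |: X).
Proof.
move=> Xconn xX Txy; pose e := [rel a b | T a b && (b \in y |: X)].
have [[[Tsym _ _] _ _] _ _] := QT.
have sub : {in X &, forall i k, connect e i k}.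
  move=> i k iX kX; apply: connect_sub (Xconn i k iX kX) => a b /andP[Tab bX].
  by apply: connect1; rewrite /e /= Tab !inE bX orbT.
have cxy : connect e x y by apply: connect1; rewrite /e /= Txy setU11.
have cyx : connect e y x by apply: connect1; rewrite /e /= Tsym Txy setU1r.
move=> i k /setU1P[->|iX] /setU1P[->|kX]; first exact: connect0.
- exact: connect_trans cyx (sub _ _ xX kX).
- exact: connect_trans (sub _ _ iX xX) cxy.
- exact: sub.
Qed.

Lemma junction_tree_glue (R : realType) (r : 'I_m)
    (p : forall i, distr R (Q i)) :
  (forall x y, T x y ->
     marginal (Q x :&: Q y) (p x) = marginal (Q x :&: Q y) (p y)) ->
  exists W (q : distr R W), forall i, Q i \subset W /\ marginal (Q i) q = p i.
Proof.
move=> p_cons; have [Ttree _ _] := QT.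
(* [W] is covered by the cliques of [X], so that each of its items can be traced to some [Q i], as
   running intersection requires. *)
have grow k : (k < m)%N -> exists X (W : {set A}) (q : distr R W),
    [/\ #|X| = k.+1, r \in X, connected_in X,
        {in W, forall a, exists2 i, i \in X & a \in Q i} &
        {in X, forall i, Q i \subset W /\ marginal (Q i) q = p i}].
  elim: k => [_|k IHk km].
    exists [set r], (Q r), (p r); split; rewrite ?cards1 ?set11 //.
    - by move=> i j /set1P-> /set1P->; apply: connect0.
    - by move=> a aQ; exists r; rewrite ?set11.
    - move=> i /set1P->; split=> //; apply: distrP => z; rewrite marginalE.
      rewrite (big_pred1 z) // => z'; congr (_ == _); apply/ffunP => a.
      by rewrite (restrictE _ (valP a)); congr (z' _); apply: val_inj.
  have [X [W [q [Xk rX Xconn WX Xq]]]] := IHk (ltnW km).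
  have [l lX] : exists l, l \notin X.
    apply/existsP; rewrite -negb_forall; apply/negP => /forallP allX.
    by move: km; rewrite -Xk -[m in (_ < m)%N]card_ord ltnNge subset_leq_card //;
       apply/fintype.subsetP.
  have [x [y [xX yX Txy]]] := tree_frontier Ttree rX lX.
  have [QxW qx] := Xq x xX.
  have SE : Q x :&: Q y = W :&: Q y.
    apply/setP => a; rewrite !inE; apply/andP/andP => [] [aQ aQy]; split=> //.
      exact: fintype.subsetP QxW a aQ.
    have [i iX aQi] := WX a aQ.
    exact: running_intersection Xconn iX xX yX Txy aQi aQy.
  have qS : marginal (Q x :&: Q y) q = marginal (Q x :&: Q y) (p y).
    by rewrite -p_cons // -qx marginal_comp ?subsetIl.
  have [q' [q'W q'y]] := distr_glue SE qS.
  exists (y |: X), (W :|: Q y), q'; split.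
  - by rewrite cardsU1 yX Xk.
  - exact: setU1r.
  - exact: connected_in_add Xconn xX Txy.
  - move=> a /setUP[/WX[i iX aQi]|aQy]; last by exists y; rewrite ?setU11.
    by exists i => //; apply: setU1r.
  - move=> i /setU1P[->|/Xq[QiW qi]]; first by split=> //; apply: finset.subsetUr.
    split; first exact: fintype.subset_trans QiW (finset.subsetUl _ _).
    by rewrite -qi -q'W marginal_comp.
have m_gt0 : (0 < m)%N by apply: leq_ltn_trans (ltn_ord r).
(* The sets grown have size [k.+1], so [k = m.-1] reaches all nodes. *)
have [|X [W [q [Xm _ _ _ Xq]]]] := grow m.-1; first by rewrite prednK.
exists W, q => i; apply: Xq.
have /eqP-> : X == [set: 'I_m] by rewrite eqEcard finset.subsetT Xm finset.cardsT card_ord prednK //=.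
by rewrite inE.
Qed.

End JunctionTrees.

(** * Equality of the two infima *)

Lemma separator_edge (A : finType) m (Q : 'I_m -> {set A}) x y :
  separator Q [set x; y] = Q x :&: Q y.
Proof.
apply/setP => a; rewrite !inE; apply/forall_inP/andP => [aQ|[ax ay] i].
  by split; apply: aQ; rewrite !inE eqxx ?orbT.
by case/set2P => ->.
Qed.

Theorem theorem9 (R : realType) (A : finType) (F : {set {set A}})
    (theta : {set A} -> R) (B C : {set A})
    (f : distr R [set: A] -> R) (fB : distr R B -> R)
    (H : rel A) (m n : nat) (Q : 'I_m -> {set A}) (T : rel 'I_m)
    (E : 'I_n -> {set 'I_m}) (r : 'I_m) :
  antimonotonic F ->
  frequencies F theta ->
  (forall p : distr R [set: A], f p = fB (marginal B p)) ->
  min_safe R F B C ->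
  simple_graph C H ->
  subrel (complete_on B (dependency_graph (proj F C))) H ->
  triangulated H ->
  clique_enum C H Q ->
  junction_tree Q T ->
  edge_enum T E ->
  B \subset Q r ->
  lp_value F theta fB Q E r = opt_value F theta f.
Proof.
move=> Fanti theta_freq fE [Csafe _ _] _ sub_H _ [_ QE] QT [_ EE] BQ.
(* The two sets of values coincide, which settles the infima, attained or not. The easy inclusion
   comes first: the marginals of a solution are feasible. *)
rewrite /lp_value /opt_value; congr ereal_inf; apply/seteqP; split=> v /=; last first.
  move=> [p pF <-]; exists (fun i => marginal (Q i) p).
  exists (fun j => marginal (separator Q (E j)) p); split; last first.
    by rewrite fE marginal_comp.
  split=> [i|i j iE]; first exact: satisfies_marginal (finset.subsetT _) pF.
  rewrite marginal_comp //; apply/fintype.subsetP => a.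
  by rewrite inE => /forall_inP; apply.
move=> [p [q [[pF pq] ->]]].
(* Both ends of an edge share the same [q j]. *)
have p_cons x y : T x y ->
    marginal (Q x :&: Q y) (p x) = marginal (Q x :&: Q y) (p y).
  move=> Txy; have : [set x; y] \in edges T by apply/imsetP; exists (x, y); rewrite ?inE.
  rewrite -EE -separator_edge => /imsetP[j _ jE].
  by rewrite jE !pq // -jE !inE eqxx ?orbT.
have [W [w wQ]] := junction_tree_glue QT r p_cons.
have QC i : Q i \subset C.
  have : Q i \in [set Q i | i : 'I_m] by apply: imset_f.
  by rewrite QE inE => /maxsetp/andP[].
have wF : satisfies (proj F C) theta (marginal C w).
  move=> U; rewrite inE => /andP[UF UC].
  have /maxset_exists[K] : clique C H U.
    rewrite /clique UC; apply/forall_inP => a aU; apply/forall_inP => b bU.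
    (* Antimonotonicity puts each pair of items of [U] in [F], making it an edge of [H]. *)
    have abU : [set a; b] \subset U by apply/fintype.subsetP => c /set2P[]->.
    apply/implyP => ab; apply: sub_H; apply/orP; left.
    rewrite /dependency_graph ab inE (Fanti _ _ abU UF).
    exact: fintype.subset_trans abU UC.
  rewrite -/(maximal_clique C H K) => maxK UK.
  have : K \in [set Q i | i : 'I_m] by rewrite QE inE.
  case/imsetP=> i _ KQ; rewrite {K maxK}KQ in UK.
  (* As [Q i] lies in [C], passing through [C] keeps the marginal on [Q i] equal to [p i]. *)
  rewrite -(expectation_itemset_marginal _ UK (QC i)) marginal_comp //.
  by have [_ ->] := wQ i; apply: pF; rewrite inE UF.
have [s [sC sF]] := Csafe theta theta_freq _ wF.
exists s => //; congr (_%:E); rewrite fE; congr fB.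
(* Since [B] lies in [Q r], and so in [C], the marginals of [s], [w] and [p r] on [B] agree. *)
have [_ <-] := wQ r; rewrite marginal_comp //.
have BC := fintype.subset_trans BQ (QC r).
by rewrite -(marginal_comp s BC) sC marginal_comp.
Qed.
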